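(* Let $p\geq2$, let $d,K\ge1$ be integers, let $\mathcal{X}\subseteq\mathbb{R}^d$ be a closed convex set with $\mathcal{X}\supseteq\mathcal{B}_p^d$, and let $\varepsilon\in(0,1/2)$, $\gamma\in(1/\mathrm{poly}(d),1)$. Then, for any local oracle, $$\mathrm{Compl}_{\mathrm{HP}}^{\gamma}\big(\mathcal{F}^{0}_{\ell_p^d}(1),\mathcal{X},K,\varepsilon\big)\geq M,$$ where $M$ is (implicitly) defined by $$M:=\min\Big\{\frac{1}{(4\varepsilon)^p},\ \frac{\varepsilon^{2/3}}{8}\Big(\frac{d}{\ln(MK/\gamma)}\Big)^{1/3}\Big\}.$$
   Context: Notation. $\ell_p^d=(\mathbb{R}^d,\|\cdot\|_p)$, with dual norm $\|\cdot\|_{p^*}$, $p^*=p/(p-1)$, and $\mathcal{B}_p^d$ is its unit ball centered at the origin. $1/\mathrm{poly}(d)$ stands for the reciprocal of an (unspecified) polynomial in $d$. Function class. $\mathcal{F}^{0}_{\ell_p^d}(\mu)$ is the class of convex functions $f:\mathbb{R}^d\to\mathbb{R}$ with $\|g_x-g_y\|_{p^*}\le\mu$ for all $x,y\in\mathbb{R}^d$ and all subgradients $g_x\in\partial f(x)$, $g_y\in\partial f(y)$. Oracle model. For a class $\mathcal{F}$ of convex functions on $\mathbb{R}^d$ and a feasible set $\mathcal{X}$, an $\varepsilon$-solution for $f\in\mathcal{F}$ is an $x\in\mathcal{X}$ with $f(x)-\inf_{\mathcal{X}}f\le\varepsilon$. An oracle $\mathcal{O}$ returns an answer $\mathcal{O}_f(x)$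 for each $f\in\mathcal{F}$, $x\in\mathcal{X}$; it is local if $\mathcal{O}_f(x)=\mathcal{O}_g(x)$ whenever $f\equiv g$ in a neighborhood of $x$. A $K$-parallel deterministic algorithm works in rounds; in round $t$ it queries a batch $X^t=\{x_1^t,\ldots,x_K^t\}\subseteq\mathcal{X}$ and receives $\mathcal{O}_f(X^t)=(\mathcal{O}_f(x^t_1),\ldots,\mathcal{O}_f(x^t_K))$, where $X^1$ is fixed in advance and $X^{t+1}=U^{t+1}(X^1,\mathcal{O}_f(X^1),\ldots,X^t,\mathcal{O}_f(X^t))$ for deterministic functions $U^{t+1}$. $\mathcal{A}^K(\mathcal{O})$ is the set of such algorithms, and $T(A,f,\varepsilon)$ is the minimum number of rounds for algorithm $A$ run on $f$ to find (query) an $\varepsilon$-solution. With $\Delta(\mathcal{F})$ the set of probability distributions over $\mathcal{F}$, for $\gamma\in(0,1)$, $$\mathrm{Compl}_{\mathrm{HP}}^{\gamma}(\mathcal{F},\mathcal{X},K,\varepsilon)=\sup_{F\in\Delta(\mathcal{F})}\ \inf_{A\in\mathcal{A}^K(\mathcal{O})}\ \inf\{\tau:\ \mathbb{P}_{f\sim F}[T(A,f,\varepsilon)\le\tau]\ge\gamma\}.$$ *)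

(* Defs.v *)
From mathcomp Require Export all_boot all_order all_algebra.
From mathcomp Require Export all_classical all_reals all_analysis.
Export Order.TTheory GRing.Theory Num.Theory.
Export numFieldNormedType.Exports.

Set Implicit Arguments.
Unset Strict Implicit.
Unset Printing Implicit Defensive.

Local Open Scope classical_set_scope.
Local Open Scope ring_scope.

Section FunctionClass.
Context {R : realType} {d : nat}.
Implicit Types (p mu : R) (x y g : 'rV[R]_d) (f : 'rV[R]_d -> R).

Definition lpnorm p x : R := (\sum_(i < d) `|x ord0 i| `^ p) `^ p^-1.

Definition unit_ball p : set 'rV[R]_d := [set x | lpnorm p x <= 1].

Definition conj_exp p : R := p / (p - 1).

Definition dotp g x : R := \sum_(i < d) g ord0 i * x ord0 i.

Definition subdifferential f x : set 'rV[R]_d :=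
  [set g | forall y, f x + dotp g (y - x) <= f y].

Definition F0 p mu : set ('rV[R]_d -> R) :=
  [set f | convex_function [set: 'rV[R]_d] f /\
    forall x y gx gy, subdifferential f x gx -> subdifferential f y gy ->
      lpnorm (conj_exp p) (gx - gy) <= mu].

End FunctionClass.

Section OracleModel.
Context {R : realType} {d : nat}.
Variables (F : set ('rV[R]_d -> R)) (X : set 'rV[R]_d).

(* The infimum is taken in the extended reals: if f is unbounded below on X,
   then f has no eps-solution, since r%:E - -oo = +oo. *)
Definition eps_solution (eps : R) (f : F) (x : X) : Prop :=
  ((val f (val x))%:E - ereal_inf [set (val f y)%:E | y in X] <= eps%:E)%E.

Variable Ans : Type.

Definition local_oracle (O : F -> X -> Ans) : Prop :=
  forall (f g : F) (x : X),
    (\forall y \near val x, val f y = val g y) -> O f x = O g x.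

Variable K : nat.

Definition transcript := seq (K.-tuple X * K.-tuple Ans).

(* The update function U^(t+1) is the restriction of A to transcripts of
   length t; the first batch X^1 is A [::]. *)
Definition algorithm := transcript -> K.-tuple X.

Variable O : F -> X -> Ans.

Fixpoint run (A : algorithm) (f : F) (t : nat) : transcript :=
  if t is t'.+1 then
    let h := run A f t' in rcons h (A h, map_tuple (O f) (A h))
  else [::].

(* The batch queried in round t+1, rounds being numbered from 1. *)
Definition batch (A : algorithm) (f : F) (t : nat) : K.-tuple X :=
  A (run A f t).

(* T(A, f, eps), equal to +oo if no eps-solution is ever queried. *)
Definition rounds (A : algorithm) (f : F) (eps : R) : \bar R :=
  ereal_inf [set t.+1%:R%:E | t in
    [set t | exists i : 'I_K, eps_solution eps f (tnth (batch A f t) i)]].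

(* A distribution over F is given as the law of a random element phi of F on
   a probability space. Oracles and algorithms are arbitrary functions, so the
   event below need not be measurable; its probability is taken as the outer
   probability, which agrees with P on measurable events and can only make
   the number of rounds smaller. *)
Definition rounds_HP disp (Omega : measurableType disp)
    (P : probability Omega R) (phi : Omega -> F) (A : algorithm)
    (eps gamma : R) : \bar R :=
  ereal_inf [set tau%:R%:E | tau in [set tau : nat |
    (gamma%:E <= mu_ext P [set w | rounds A (phi w) eps <= tau%:R%:E])%E]].

Definition Compl_HP (eps gamma : R) : \bar R :=
  ereal_sup [set c | exists disp (Omega : measurableType disp)
      (P : probability Omega R) (phi : Omega -> F),
    (forall x, measurable_fun setT (fun w => val (phi w) x)) /\
    c = ereal_inf [set rounds_HP P phi A eps gamma | A in [set: algorithm]]].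

End OracleModel.

(* Main.v *)
(** Split N blocks of b coordinates off the space, N being the largest integer
    below M, and give each coordinate a random sign.  The hard function is half
    the maximum of the signed block sums, the i-th one lowered by i * gap, of
    block norms minus 2, and of -2.  Against an oracle that only reveals the
    first t + 1 block sums in round t + 1, the queries of that round are
    independent of the signs of the blocks t, ..., N - 1, so by Hoeffding's
    inequality these blocks have small sums at every query: the later block sums
    are then locally inactive, which makes the restricted answers the true
    ones, and block t keeps the value above -eps, while the minimum over the
    unit ball is at most -2 eps. *)

From HB Require Import structures.
Require Import Defs.
From mathcomp Require Import ring lra.

Set Implicit Arguments.
Unset Strict Implicit.
Unset Printing Implicit Defensive.

Local Open Scope classical_set_scope.
Local Open Scope ring_scope.

(** * Inequalities for finite sums *)

Section FiniteSums.
Context {R : realType} {I : finType}.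
Implicit Types (P : pred I) (a b : I -> R) (p : R).

Lemma sum_sqr_ge0 P a : 0 <= \sum_(k | P k) a k ^+ 2.
Proof. by apply: sumr_ge0 => k _; exact: sqr_ge0. Qed.

Lemma cauchy_schwarz_sum P a b :
  \sum_(k | P k) a k * b k <=
  Num.sqrt (\sum_(k | P k) a k ^+ 2) * Num.sqrt (\sum_(k | P k) b k ^+ 2).
Proof.
rewrite -sqrtrM ?sum_sqr_ge0// (le_trans (ler_norm _))// -sqrtr_sqr ler_wsqrtr//.
rewrite -(ler_pM2l (ltr0Sn R 1)) [leRHS]mulr_natl mulr2n [X in _ <= _ + X]mulrC.
rewrite !big_distrlr/= -big_split/=.
rewrite expr2 big_distrlr/= mulr_sumr; apply: ler_sum => i _.
rewrite -big_split/= mulr_sumr; apply: ler_sum => j _.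
have := sqr_ge0 (a i * b j - b i * a j); nra.
Qed.

Lemma sqrt_sum_sqrD P a b :
  Num.sqrt (\sum_(k | P k) (a k + b k) ^+ 2) <=
  Num.sqrt (\sum_(k | P k) a k ^+ 2) + Num.sqrt (\sum_(k | P k) b k ^+ 2).
Proof.
rewrite -[leRHS]ger0_norm ?addr_ge0 ?sqrtr_ge0// -sqrtr_sqr ler_wsqrtr//.
rewrite sqrrD !sqr_sqrtr ?sum_sqr_ge0//.
have -> : \sum_(k | P k) (a k + b k) ^+ 2 = \sum_(k | P k) a k ^+ 2 +
    2 * (\sum_(k | P k) a k * b k) + \sum_(k | P k) b k ^+ 2.
  by rewrite mulr_sumr -!big_split/=; apply: eq_bigr => k _; ring.
rewrite lerD2r lerD2l -[leRHS]mulr_natl ler_pM2l//.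
exact: cauchy_schwarz_sum.
Qed.

(** For [r > 1] this is Young's inequality for [t] and 1, with exponent [r] and its conjugate. *)
Lemma bernoulli_powR (t r : R) : 0 <= t -> 1 <= r -> 1 + r * (t - 1) <= t `^ r.
Proof.
move=> t0; rewrite le_eqVlt => /predU1P[<-|r1]; first by rewrite powRr1//; lra.
have r0 : 0 < r by lra.
have ir1 : r^-1 < 1 by rewrite invf_lt1.
have := @conjugate_powR R t 1 r (1 - r^-1)^-1 t0 ler01 r0.
rewrite invr_gt0 subr_gt0 invrK powR1 mulr1 addrC subrK => /(_ ir1 erefl).
rewrite mul1r -(ler_pM2l r0) mulrDr mulrBr mulrCA divff ?gt_eqF// !mulr1; lra.
Qed.

(** Tangent-line argument: with [m] the quadratic mean, Bernoulli's inequality at [(|a k| / m) ^+ 2]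
    with exponent [p / 2] is summed over [k], and the linear terms cancel. *)
Lemma power_mean_sqr P a (b : nat) p : 2 <= p -> (0 < b)%N -> #|P| = b ->
  b%:R * Num.sqrt (b%:R^-1 * \sum_(k | P k) a k ^+ 2) `^ p <=
  \sum_(k | P k) `|a k| `^ p.
Proof.
move=> p2 b0 cP; set m := Num.sqrt _.
have b0' : 0 < b%:R :> R by rewrite ltr0n.
have /predU1P[m0|m0] : (m == 0) || (0 < m) by rewrite -le0r sqrtr_ge0.
  rewrite m0 powR0 ?mulr0; last by rewrite gt_eqF//; lra.
  by apply: sumr_ge0 => k _; exact: powR_ge0.
have m2 : \sum_(k | P k) a k ^+ 2 = b%:R * m ^+ 2.
  rewrite sqr_sqrtr ?mulr_ge0 ?invr_ge0 ?ler0n ?sum_sqr_ge0//.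
  by rewrite mulVKf ?gt_eqF.
have -> : b%:R * m `^ p =
    \sum_(k | P k) m `^ p * (1 + p / 2 * ((`|a k| / m) ^+ 2 - 1)).
  rewrite -mulr_sumr big_split/= -mulr_sumr big_split/= sumr_const.
  rewrite (eq_bigr (fun k => m ^- 2 * a k ^+ 2)); last first.
    by move=> k _; rewrite expr_div_n real_normK ?num_real// mulrC.
  rewrite -mulr_sumr m2 sumr_const cP mulrCA mulVf ?expf_neq0 ?gt_eqF//.
  by rewrite mulr1 mulNrn subrr mulr0 addr0 mulrC.
apply: ler_sum => k _.
have -> : `|a k| `^ p = m `^ p * ((`|a k| / m) ^+ 2) `^ (p / 2).
  rewrite -powR_mulrn ?divr_ge0 ?(ltW m0)// -powRrM mulrCA divff// mulr1.
  by rewrite -powRM ?divr_ge0 ?(ltW m0)// mulrC divfK ?gt_eqF.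
by rewrite ler_wpM2l ?powR_ge0// bernoulli_powR ?sqr_ge0//; lra.
Qed.

End FiniteSums.

(** * Hoeffding's inequality for random signs, by counting *)

Section Hoeffding.
Context {R : realType}.

(** The constant 2, weaker than the sharp 1/2, needs only [1 + x <= expR x]: for [x >= 1/2] one has
    [x <= 2 * x ^+ 2], and for [0 <= x < 1/2] the left side is at most
    [1 / (1 - x ^+ 2) <= 1 + 2 * x ^+ 2]. *)
Lemma cosh_le_expR_sqr (x : R) : (expR x + expR (- x)) / 2 <= expR (2 * x ^+ 2).
Proof.
wlog x0 : x / 0 <= x => [H|].
  have [/H//|x0] := leP 0 x.
  by have := H (- x); rewrite opprK sqrrN addrC oppr_ge0; apply; exact: ltW.
have [x12|x12] := leP (2^-1) x.
  have : expR (- x) <= expR x by rewrite ler_expR; lra.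
  have : expR x <= expR (2 * x ^+ 2) by rewrite ler_expR; nra.
  lra.
have e1 : expR x * (1 - x) <= 1.
  by rewrite -[leRHS]expR0 -(subrr x) expRD ler_pM2l ?expR_gt0//; exact: expR_ge1Dx.
have e2 : expR (- x) * (1 + x) <= 1.
  by rewrite -[leRHS]expR0 -(addNr x) expRD ler_pM2l ?expR_gt0//; exact: expR_ge1Dx.
have e3 := expR_ge1Dx (2 * x ^+ 2).
rewrite (le_trans _ e3)// -(@ler_pM2r _ (2 * (1 - x) * (1 + x))); last by rewrite !mulr_gt0//; lra.
have -> : (expR x + expR (- x)) / 2 * (2 * (1 - x) * (1 + x)) =
  expR x * (1 - x) * (1 + x) + expR (- x) * (1 + x) * (1 - x) by field.
have : expR x * (1 - x) * (1 + x) <= 1 * (1 + x) by rewrite ler_wpM2r//; lra.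
have : expR (- x) * (1 + x) * (1 - x) <= 1 * (1 - x) by rewrite ler_wpM2r//; lra.
have := sqr_ge0 x.
have : 0 <= x ^+ 2 * (2^-1 - x ^+ 2) by rewrite mulr_ge0 ?sqr_ge0//; nra.
lra.
Qed.

Context {I : finType}.
Implicit Types (P : pred I) (a : I -> R).

(** The exponential factors over coordinates, so the sum over sign vectors is a product of two-term
    sums; a coordinate outside [P] contributes 2. *)
Lemma sum_expR_signs P a :
  \sum_(u : {ffun I -> bool}) expR (\sum_(k | P k) (-1) ^+ u k * a k) <=
  2 ^+ #|I| * expR (2 * \sum_(k | P k) a k ^+ 2).
Proof.
pose F k (c : bool) : R := if P k then expR ((-1) ^+ c * a k) else 1.
rewrite (eq_bigr (fun u : {ffun I -> bool} => \prod_k F k (u k))); last first.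
  by move=> u _; rewrite expR_sum big_mkcond.
rewrite -(bigA_distr_bigA F) /= mulr_sumr expR_sum.
rewrite -[#|I|]/(#|{: I}|) -prodr_const [X in _ <= _ * X]big_mkcond -big_split/=.
apply: ler_prod => k _; rewrite big_bool /F; case: ifP => [Pk|_].
  rewrite expr1 mulN1r expr0 mul1r addr_ge0 ?expR_ge0//=.
  by rewrite addrC -ler_pdivrMl// mulrC cosh_le_expR_sqr.
by rewrite mulr1 addr_ge0//= lexx.
Qed.

(** Chernoff's method: the moment bound above with Markov's inequality, written with
    cardinalities. *)
Lemma hoeffding_signs P a (c : R) : 0 <= c ->
  #|[pred u : {ffun I -> bool} |
     c * Num.sqrt (\sum_(k | P k) a k ^+ 2) < \sum_(k | P k) (-1) ^+ u k * a k]|%:R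
  <= 2 ^+ #|I| * expR (- (c ^+ 2 / 8)).
Proof.
move=> c0; set S := \sum_(k | P k) a k ^+ 2.
have S0 : 0 <= S by apply: sumr_ge0 => k _; exact: sqr_ge0.
set B := [pred u | _].
have [S00|Sn0] := eqVneq S 0.
  rewrite eq_card0 ?mulr_ge0 ?exprn_ge0 ?expR_ge0// => u; apply/negbTE.
  rewrite inE S00 sqrtr0 mulr0 -leNgt big1// => k Pk.
  move/eqP: S00; rewrite psumr_eq0 => [/allP/(_ k (mem_index_enum k))|i _].
    by rewrite Pk sqrf_eq0 => /eqP ->; rewrite mulr0.
  exact: sqr_ge0.
have q0 : 0 < Num.sqrt S by rewrite sqrtr_gt0 lt_def Sn0.
(* The minimizer of [2 * l ^+ 2 * S - l * (c * Num.sqrt S)]; the minimum is [- (c ^+ 2 / 8)]. *)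
pose l := c / (4 * Num.sqrt S).
have l0 : 0 <= l by rewrite divr_ge0// mulr_ge0 ?ltW.
have lS : l * (c * Num.sqrt S) = c ^+ 2 / 4.
  by rewrite /l; field; rewrite gt_eqF.
have lS2 : 2 * (l ^+ 2 * S) = c ^+ 2 / 8.
  by rewrite -[X in _ * (_ * X)](sqr_sqrtr S0) /l; field; rewrite gt_eqF.
have step : #|B|%:R * expR (c ^+ 2 / 4) <= 2 ^+ #|I| * expR (c ^+ 2 / 8).
  have := sum_expR_signs P (fun k => l * a k).
  rewrite [X in expR (2 * X)](_ : _ = l ^+ 2 * S); last first.
    by rewrite /S mulr_sumr; apply: eq_bigr => k _; rewrite exprMn.
  rewrite lS2; apply: le_trans.
  rewrite mulr_natl -sumr_const [leLHS]big_mkcond/=; apply: ler_sum => u _.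
  case: ifPn => [uB|_]; last exact: expR_ge0.
  rewrite ler_expR -lS [leRHS](_ : _ = l * \sum_(k | P k) (-1) ^+ u k * a k).
    by rewrite ler_wpM2l// ltW.
  by rewrite mulr_sumr; apply: eq_bigr => k _; rewrite mulrCA.
rewrite -(ler_pM2r (expR_gt0 (c ^+ 2 / 4))) (le_trans step)// -[leRHS]mulrA -expRD.
by rewrite ler_wpM2l ?exprn_ge0// ler_expR; lra.
Qed.

End Hoeffding.

(** * Dual norms and membership in the function class *)

Section DualNorm.
Context {R : realType} {d : nat}.
Implicit Types (p c : R) (x y g v : 'rV[R]_d) (f h : 'rV[R]_d -> R).

Lemma lpnorm_dual_le1 p g : 1 < p ->
  (forall v, dotp g v <= lpnorm p v) -> lpnorm (conj_exp p) g <= 1.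
Proof.
move=> p1 H; have p0 : 0 < p by lra.
set q := conj_exp p.
have q1 : 1 < q by rewrite /q /conj_exp ltr_pdivlMr ?subr_gt0//; lra.
have qp : (q - 1) * p = q by rewrite /q /conj_exp; field; lra.
set S := \sum_(i < d) `|g ord0 i| `^ q.
have S0 : 0 <= S by apply: sumr_ge0 => i _; exact: powR_ge0.
suff S1 : S <= 1.
  rewrite /lpnorm -/S; have <- : 1 `^ q^-1 = 1 :> R by rewrite powR1.
  by rewrite ge0_ler_powR ?nnegrE ?invr_ge0//; lra.
rewrite leNgt; apply/negP => S1.
(* The Hölder-extremal vector of g turns the hypothesis into S <= S^(1/p). *)
have := H (\row_i (Num.sg (g ord0 i) * `|g ord0 i| `^ (q - 1))).
have -> : dotp g (\row_i (Num.sg (g ord0 i) * `|g ord0 i| `^ (q - 1))) = S.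
  apply: eq_bigr => i _; rewrite mxE mulrA [_ * Num.sg _]mulrC -normrEsg.
  have [->|gi] := eqVneq (g ord0 i) 0; first by rewrite normr0 mul0r powR0//; lra.
  by rewrite -[X in X * _]powRr1// -powRD ?[1 + _]addrC ?subrK// normr_eq0 gi implybT.
rewrite /lpnorm [X in _ <= X `^ _](_ : _ = S); last first.
  apply: eq_bigr => i _; rewrite mxE normrM [`|_ `^ _|]ger0_norm ?powR_ge0//.
  have [->|gi] := eqVneq (g ord0 i) 0.
    by rewrite normr0 sgr0 normr0 mul0r !powR0//; lra.
  by rewrite normr_sg gi mul1r -powRrM qp.
apply/negP; rewrite -ltNge -ltr_ln ?posrE ?powR_gt0 ?(lt_trans ltr01)//.
by rewrite ln_powR gtr_pMl ?invf_lt1// ln_gt0.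
Qed.

Definition lp_sublinear p h :=
  [/\ forall x y, h (x + y) <= h x + h y,
      forall (t : R) x, 0 <= t -> h (t *: x) = t * h x &
      forall x, h x <= lpnorm p x].

(** The factor 1/2 makes the function 1/2-Lipschitz: a subgradient pairs with [v] to at most half of
    [lpnorm p v], and a difference of two to at most [lpnorm p v]. *)
Lemma F0_half_max p (I : finType) (P : pred I) (h : I -> 'rV[R]_d -> R)
    (c : I -> R) (m : R) : 1 < p -> (forall i, lp_sublinear p (h i)) ->
  F0 p 1 (fun x => 2^-1 * \big[Num.max/m]_(i | P i) (h i x - c i)).
Proof.
move=> p1 hh; set f := fun x => _.
have fP (x : 'rV_d) (r : R) :
    (f x <= r) <-> m <= 2 * r /\ forall i, P i -> h i x - c i <= 2 * r.
  rewrite /f -(@ler_pM2l _ 2)// mulrA divff// mul1r.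
  by split => [/bigmax_leP|H]//; exact/bigmax_leP.
clearbody f; have f0 x : 0 <= lpnorm p x by exact: powR_ge0.
have Lip x v : f (x + v) <= f x + 2^-1 * lpnorm p v.
  have /fP[fm fh] := lexx (f x).
  apply/fP; split => [|i Pi]; first by have := f0 v; lra.
  have [hD _ hl] := hh i.
  by have := fh _ Pi; have := hD x v; have := hl v; lra.
split; last first.
  move=> x y gx gy gxP gyP; apply: lpnorm_dual_le1 => // v.
  have -> : dotp (gx - gy) v = dotp gx v + dotp gy (- v).
    by rewrite /dotp -big_split/=; apply: eq_bigr => i _; rewrite !mxE; ring.
  have vN : lpnorm p (- v) = lpnorm p v.
    by rewrite /lpnorm; under eq_bigr do rewrite mxE normrN.
  have half w z g : subdifferential f z g -> dotp g w <= 2^-1 * lpnorm p w.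
    move=> /(_ (z + w)); rewrite [z + w - z]addrAC subrr add0r => gz.
    by rewrite -(lerD2l (f z)) (le_trans gz) ?Lip.
  have := lerD (half v _ _ gxP) (half (- v) _ _ gyP).
  by rewrite vN [2^-1 * _]mulrC -splitr.
move=> t x y _ _.
have [t0 t1] : 0 <= t%:num /\ t%:num <= 1 by split.
have -> : conv t (f x : R^o) (f y : R^o) = t%:num * f x + (1 - t%:num) * f y :> R.
  by [].
have -> : conv t (x : convex_lmodType 'rV[R]_d) y =
  t%:num *: x + (1 - t%:num) *: y :> 'rV[R]_d by [].
set s := t%:num in t0 t1 *.
have /fP[fmx fhx] := lexx (f x).
have /fP[fmy fhy] := lexx (f y).
apply/fP; split => [|i Pi]; first nra.
have [hD hZ _] := hh i.
have := hD (s *: x) ((1 - s) *: y); rewrite !hZ//; last lra.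
have := ler_wpM2l t0 (fhx _ Pi).
have : 0 <= 1 - s by lra.
by move=> /ler_wpM2l/(_ _ _ (fhy _ Pi)); lra.
Qed.

End DualNorm.

(** * The hard functions *)

Section HardFamily.
Context {R : realType} {d : nat}.
Variables (p : R) (N b : nat) (eps : R).
Hypotheses (b0 : (0 < b)%N) (Nbd : (N * b <= d)%N).
Implicit Types (x y : 'rV[R]_d) (r : {ffun 'I_d -> bool}) (i : nat).

Definition in_block i : pred 'I_d := fun k => (k %/ b == i)%N.

Lemma card_block i : (i < N)%N -> #|in_block i| = b.
Proof.
move=> iN.
have lt_d (j : 'I_b) : (i * b + j < d)%N.
  apply: leq_trans Nbd; apply: (@leq_trans (i.+1 * b)); last by rewrite leq_mul2r iN orbT.
  by rewrite mulSn addnC ltn_add2r.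
pose F j := Ordinal (lt_d j).
have Finj : injective F by move=> j j' [/addnI/val_inj].
rewrite -[RHS]card_ord -(card_codom Finj); apply: eq_card => k.
apply/idP/codomP => [|[j ->]]; rewrite unfold_in.
  move=> /eqP ki; exists (Ordinal (ltn_pmod k b0)); apply: val_inj => /=.
  by rewrite -ki -divn_eq.
by rewrite /= divnMDl// divn_small// addn0.
Qed.

(** Hölder normalization: a signed sum of [b] entries is at most [b ^ (1 - 1/p)] times the
    [p]-norm. *)
Let scale : R := b%:R `^ (p^-1 - 1).

Definition block_form r i x : R :=
  scale * \sum_(k | in_block i k) (-1) ^+ r k * x ord0 k.

(** This is [b ^ (1/p)] times the quadratic mean of the block, which lies between the block form and
    the [p]-norm; a random block form has typical size [block_norm / sqrt b]. *)
Definition block_norm i x : R :=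
  scale * (Num.sqrt b%:R * Num.sqrt (\sum_(k | in_block i k) x ord0 k ^+ 2)).

(** For [i < N] the lowering [i * gap] stays below [2 * eps], while [gap] equals six slacks: room
    for two errors [slack * block_norm] at norm 3. *)
Definition gap : R := 2 * eps / N%:R.
Definition slack : R := eps / (3 * N%:R).

(** The norm pieces, present for every [t], carry no sign information; they take over at far points,
    where the error [slack * block_norm] could exceed [gap]. Taking [t = N] gives the full
    function. *)
Definition hard r (t : nat) x : R :=
  2^-1 * \big[Num.max/(- 2)]_(ic : 'I_N * bool | ic.2 || (ic.1 <= t)%N)
    ((if ic.2 then block_norm ic.1 else block_form r ic.1) x
     - (if ic.2 then 2 else ic.1%:R * gap)).

(** The bound on block [t] keeps the value high, those on later blocks keep them inactive; errors
    are relative to [block_norm], as Hoeffding's inequality provides. *)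
Definition good r (t : nat) x :=
  - block_form r t x <= slack * block_norm t x /\
  forall j, (t < j < N)%N -> block_form r j x <= slack * block_norm j x.

Lemma hard_le r t x (c : R) : (hard r t x <= c) <->
  [/\ - 1 <= c, forall i, (i < N)%N -> block_norm i x - 2 <= 2 * c &
      forall i, (i < N)%N -> (i <= t)%N -> block_form r i x - i%:R * gap <= 2 * c].
Proof.
rewrite /hard -(@ler_pM2l _ 2)// mulrA divff// mul1r.
split => [/bigmax_leP[h0 h]|[h0 hn hf]].
  split => [|i iN|i iN it]; first lra.
    exact: (h (Ordinal iN, true)).
  exact: (h (Ordinal iN, false)).
apply/bigmax_leP; split => [|[i [] /= it]]; first lra.
  exact: hn.
exact: hf.
Qed.

Lemma scale_ge0 : 0 <= scale. Proof. exact: powR_ge0. Qed.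

Lemma block_norm_ge0 i x : 0 <= block_norm i x.
Proof. by rewrite !mulr_ge0 ?scale_ge0 ?sqrtr_ge0. Qed.

Lemma block_form_le_norm r i x : (i < N)%N ->
  block_form r i x <= block_norm i x.
Proof.
move=> iN; rewrite ler_wpM2l ?scale_ge0//.
apply: le_trans (cauchy_schwarz_sum _ _ _) _.
under eq_bigr do rewrite sqrr_sign.
by rewrite sumr_const card_block.
Qed.

Lemma block_norm_le_lpnorm i x : 2 <= p -> (i < N)%N ->
  block_norm i x <= lpnorm p x.
Proof.
move=> p2 iN; have p0 : 0 < p by lra.
have b0' : 0 < b%:R :> R by rewrite ltr0n.
have := @power_mean_sqr R _ (in_block i) (fun k => x ord0 k) b p p2 b0 (card_block iN).
set S := \sum_(k | _) _; set m := Num.sqrt _ => H.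
have m0 : 0 <= m by exact: sqrtr_ge0.
(* Here [m] is the quadratic mean of the block, so the power mean inequality applies under the
   root. *)
have -> : block_norm i x = (b%:R * m `^ p) `^ p^-1.
  rewrite powRM ?powR_ge0// -powRrM divff ?gt_eqF// powRr1//.
  rewrite /m sqrtrM ?invr_ge0// sqrtrV// /block_norm /scale powRB; last first.
    by rewrite pnatr_eq0 -lt0n b0 implybT.
  rewrite powRr1// -[X in _ / X * _](sqr_sqrtr (ltW b0')); field.
  by rewrite gt_eqF// sqrtr_gt0.
rewrite ge0_ler_powR ?nnegrE ?invr_ge0 ?mulr_ge0 ?powR_ge0 ?(ltW p0)//.
  by apply: sumr_ge0 => k _; exact: powR_ge0.
apply: le_trans H _; rewrite /S big_mkcond/=. apply: ler_sum => k _.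
by case: ifP => _ //; exact: powR_ge0.
Qed.

Lemma hard_F0 r t : 2 <= p -> F0 p 1 (hard r t).
Proof.
move=> p2.
apply: (@F0_half_max R d p _ (fun ic : 'I_N * bool => ic.2 || (ic.1 <= t)%N)
  (fun ic => if ic.2 then block_norm ic.1 else block_form r ic.1)
  (fun ic => if ic.2 then 2 else ic.1%:R * gap)); first lra.
case=> -[i iN] [] /=; split.
- move=> x y; rewrite /block_norm -!mulrDr !ler_wpM2l ?scale_ge0 ?sqrtr_ge0//.
  by under eq_bigr do rewrite mxE; exact: sqrt_sum_sqrD.
- move=> s x s0; rewrite /block_norm.
  under eq_bigr do rewrite mxE exprMn.
  rewrite -mulr_sumr sqrtrM ?sqr_ge0// sqrtr_sqr ger0_norm//; ring.
- by move=> x; exact: block_norm_le_lpnorm.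
- move=> x y; rewrite /block_form -mulrDr -big_split/= ler_wpM2l ?scale_ge0//.
  by apply: ler_sum => k _; rewrite mxE mulrDr.
- move=> s x s0; rewrite /block_form [RHS]mulrCA; congr (_ * _); rewrite mulr_sumr.
  by apply: eq_bigr => k _; rewrite mxE mulrCA.
- move=> x; exact: le_trans (block_form_le_norm _ _ _) (block_norm_le_lpnorm _ _ _).
Qed.

(** Blocks are consecutive, so answers from [hard r t] reveal no sign of a block after [t]. *)
Lemma eq_hard r r' t : (forall k : 'I_d, (k < t.+1 * b)%N -> r k = r' k) ->
  hard r t = hard r' t.
Proof.
move=> rr'; apply/funext => x; rewrite /hard; congr (_ * _).
apply: eq_bigr => -[i []]//= it; rewrite /block_form; congr (_ * _ - _).
apply: eq_bigr => k /eqP ki; rewrite rr'//.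
by rewrite -ltn_divLR// ki.
Qed.

Lemma block_sum_continuous i (F : 'I_d -> 'rV[R]_d -> R) :
  (forall k, continuous (F k)) -> continuous (fun x => \sum_(k | in_block i k) F k x).
Proof.
by move=> cF; apply: continuous_big => [|k _]; [exact: add_continuous | exact: cF].
Qed.

Lemma block_form_continuous r i : continuous (block_form r i).
Proof.
have c : continuous (fun x => \sum_(k | in_block i k) (-1) ^+ r k * x ord0 k).
  apply: block_sum_continuous => k x.
  exact: (cvgMr (@coord_continuous R 1 d ord0 k x)).
by move=> x; exact: (cvgMr (c x)).
Qed.

Lemma block_norm_continuous i : continuous (block_norm i).
Proof.
have c : continuous (fun x : 'rV[R]_d => \sum_(k | in_block i k) x ord0 k ^+ 2).
  apply: block_sum_continuous => k x.
  exact: (cvgM (@coord_continuous R 1 d ord0 k x) (@coord_continuous R 1 d ord0 k x)).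
move=> x; exact: (cvgMr (cvgMr (continuous_comp (c x) (@sqrt_continuous _ _)))).
Qed.

Lemma gap_slack : (0 < N)%N -> gap = 6 * slack.
Proof. by move=> N0; rewrite /gap /slack; field; rewrite pnatr_eq0 -lt0n. Qed.

(* A block j > t whose norm is at least 3 is dominated by its own norm piece;
   otherwise by the form of block t, or by its norm piece if that is large. *)
Lemma hard_local r t x : 0 < eps < 2^-1 -> (t < N)%N -> good r t x ->
  \forall y \near x, hard r N y = hard r t y.
Proof.
move=> /andP[e0 e1] tN [gt gj].
have N0 : (0 < N)%N by exact: leq_ltn_trans tN.
have s0 : 0 < slack by rewrite divr_gt0// mulr_gt0// ltr0n.
have s1 : slack < 6^-1.
  rewrite ltr_pdivrMr ?mulr_gt0 ?ltr0n// mulrA.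
  have : 1 <= N%:R :> R by rewrite ler1n.
  lra.
have key (j : 'I_N) : (t < j)%N ->
    \forall y \near x, block_form r j y - j%:R * gap <= 2 * hard r t y.
  move=> tj; have tj1 : t%:R + 1 <= j%:R :> R by rewrite natr1 ler_nat.
  have g6 := gap_slack N0.
  have jg : t%:R * gap + gap <= j%:R * gap.
    by rewrite -{2}[gap]mul1r -mulrDl ler_wpM2r// g6; lra.
  have Hh y := (hard_le r t y _).1 (lexx _).
  have tg0 : 0 <= t%:R * gap by rewrite mulr_ge0// g6; lra.
  have gjx := gj _ (introT andP (conj tj (ltn_ord j))).
  have [nj3|nj3] := leP 3 (block_norm j x).
    suff : \forall y \near x, block_form r j y - block_norm j y < - 2.
      apply: filterS => y lt2.
      by have [_ /(_ _ (ltn_ord j)) hn _] := Hh y; lra.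
    apply: cvgr_lt (cvgB (@block_form_continuous r j x) (@block_norm_continuous j x)) _ _.
    by have := ler_wpM2r (block_norm_ge0 j x) (ltW s1); lra.
  have [nt3|nt3] := leP (block_norm t x) 3.
    suff : \forall y \near x, block_form r j y - block_form r t y < gap.
      apply: filterS => y ltg.
      by have [_ _ /(_ _ tN (leqnn t)) hf] := Hh y; lra.
    apply: cvgr_lt (cvgB (@block_form_continuous r j x) (@block_form_continuous r t x)) _ _.
    (* The two errors sum to less than [6 * slack = gap], strictly because the norm of block [j] is
       below 3. *)
    have : slack * block_norm j x < slack * 3 by rewrite ltr_pM2l.
    have : slack * block_norm t x <= slack * 3 by rewrite ler_pM2l.
    lra.
  (* The form of block [j] is below [gap / 2] at [x], while the norm of block [t] exceeds 3. *)
  suff : \forall y \near x, block_form r j y - block_norm t y < gap - 2.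
    apply: filterS => y ltg.
    by have [_ /(_ _ tN) hn _] := Hh y; lra.
  apply: cvgr_lt (cvgB (@block_form_continuous r j x) (@block_norm_continuous t x)) _ _.
  have : slack * block_norm j x < slack * 3 by rewrite ltr_pM2l.
  lra.
suff : \forall y \near x, forall j : 'I_N, (t < j)%N ->
    block_form r j y - j%:R * gap <= 2 * hard r t y.
  apply: filterS => y {}key.
  apply/eqP; rewrite eq_le; apply/andP; split.
    have [h1 hn hf] := (hard_le r t y _).1 (lexx _).
    apply/hard_le; split => // j jN _.
    have [jt|tj] := leqP j t; first exact: hf.
    exact: (key (Ordinal jN)).
  have [h1 hn hf] := (hard_le r N y _).1 (lexx _).
  by apply/hard_le; split => // j jN _; apply: hf => //; exact: ltnW.
apply: (@filter_forall _ _ _ _ (nbhs_filter x)) => j.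
case: (boolP (t < j)%N) => tj; last exact: nearW.
by apply: filterS (key j tj) => y.
Qed.

(** If block [t] has norm at most 3, its form piece is at least [- (3 + 6 * t) * slack], above
    [- 6 * N * slack = - 2 * eps] since [t + 1 <= N]; otherwise its norm piece exceeds 1. *)
Lemma hard_gt r t x : 0 < eps < 2^-1 -> (t < N)%N -> good r t x ->
  - eps < hard r N x.
Proof.
move=> /andP[e0 e1] tN [gt gj].
have N0 : (0 < N)%N by exact: leq_ltn_trans tN.
have s0 : 0 < slack by rewrite divr_gt0// mulr_gt0// ltr0n.
have [_ hn hf] := (hard_le r N x _).1 (lexx _).
have := hn _ tN; have := hf _ tN (ltnW tN); rewrite gap_slack//.
have [nt3|nt3] := leP (block_norm t x) 3; last lra.
have : slack * block_norm t x <= slack * 3 by rewrite ler_pM2l.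
have tN1 : t%:R + 1 <= N%:R :> R by rewrite natr1 ler_nat.
have : slack * (3 * N%:R) = eps.
  by rewrite /slack divfK// mulf_neq0// pnatr_eq0 -lt0n.
have := ler_wpM2l (ltW s0) tN1.
lra.
Qed.

(** The witness opposes every sign: equal magnitudes on the [N * b] block coordinates and [p]-norm 1
    give each form the value [- N ^ (-1/p)], at most [- 4 * eps] by the bound on [N]. *)
Lemma hard_min r : 1 < p -> (0 < N)%N -> N%:R <= 1 / (4 * eps) `^ p -> 0 < eps ->
  exists2 x, lpnorm p x <= 1 & hard r N x <= - (2 * eps).
Proof.
move=> p1 N0 NM e0; have p0 : 0 < p by lra.
have Nb0 : 0 < (N * b)%:R :> R by rewrite ltr0n muln_gt0 N0.
pose c : R := (N * b)%:R `^ (- p^-1).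
have c0 : 0 <= c by exact: powR_ge0.
pose x : 'rV[R]_d := \row_k (if (k < N * b)%N then - (c * (-1) ^+ r k) else 0).
have xE i k : (i < N)%N -> in_block i k -> x ord0 k = - (c * (-1) ^+ r k).
  move=> iN /eqP ki; rewrite mxE -ltn_divLR// ki iN//.
have scE : scale * b%:R = b%:R `^ p^-1.
  rewrite /scale -[X in _ * X]powRr1 ?ler0n// -powRD ?subrK//.
  by rewrite pnatr_eq0 -lt0n b0 implybT.
pose u : R := N%:R `^ (- p^-1).
have bcu : b%:R `^ p^-1 * c = u.
  rewrite /c natrM powRM ?ler0n// mulrCA -powRD.
    by rewrite subrr powRr0 mulr1.
  by rewrite pnatr_eq0 -lt0n b0 implybT.
have formx i : (i < N)%N -> block_form r i x = - u.
  move=> iN; rewrite /block_form (eq_bigr (fun=> - c)).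
    by rewrite sumr_const card_block// -mulr_natl mulrA scE mulrN bcu.
  by move=> k ki; rewrite (xE i)// mulrN mulrCA -expr2 sqrr_sign mulr1.
have normx i : (i < N)%N -> block_norm i x = u.
  move=> iN; rewrite /block_norm (eq_bigr (fun=> c ^+ 2)).
    rewrite sumr_const card_block// -[c ^+ 2 *+ _]mulr_natl sqrtrM ?ler0n// sqrtr_sqr ger0_norm//.
    by rewrite [X in _ * X]mulrA -expr2 sqr_sqrtr ?ler0n// mulrA scE bcu.
  by move=> k ki; rewrite (xE i)// sqrrN exprMn sqrr_sign mulr1.
have u1 : u <= 1.
  rewrite /u powRN invf_le1 ?powR_gt0 ?ltr0n//.
  apply: (@le_trans _ _ (1 `^ p^-1)); first by rewrite powR1.
  by rewrite ge0_ler_powR ?nnegrE ?invr_ge0 ?(ltW p0) ?ler1n.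
have e4 : 4 * eps <= u.
  have e40 : 0 < 4 * eps by rewrite mulr_gt0.
  have : N%:R^-1 >= (4 * eps) `^ p.
    by rewrite -[leLHS]invrK lef_pV2 ?posrE ?invr_gt0 ?powR_gt0 ?ltr0n// -div1r.
  move=> /(@ge0_ler_powR _ p^-1).
  rewrite !nnegrE ?invr_ge0 ?powR_ge0 ?(ltW p0) ?ler0n// => /(_ erefl erefl erefl).
  rewrite -powRrM divff ?gt_eqF// powRr1 ?(ltW e40)// => /le_trans; apply.
  by rewrite /u -[N%:R^-1]powR_inv1 ?ler0n// -powRrM mulN1r.
exists x.
  rewrite /lpnorm (eq_bigr (fun k : 'I_d => if (k < N * b)%N then (N * b)%:R^-1 else 0)).
    rewrite -big_mkcond/= sumr_const.
    have -> : #|[pred k : 'I_d | (k < N * b)%N]| = (N * b)%N.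
      have Finj : injective (widen_ord Nbd).
        by move=> i j /(congr1 val) ij; exact: val_inj.
      rewrite -[RHS]card_ord -(card_codom Finj); apply: eq_card => k.
      apply/idP/codomP => [kN|[j ->]]; last by rewrite unfold_in/=.
      by exists (Ordinal kN); apply: val_inj.
    by rewrite -[_^-1 *+ _]mulr_natl divff ?gt_eqF// powR1.
  move=> k _; rewrite mxE; case: ifP => _; last first.
    by rewrite normr0 powR0// gt_eqF.
  rewrite normrN normrM normr_sign mulr1 ger0_norm// /c -powRrM mulNr.
  by rewrite mulVf ?gt_eqF// powR_inv1 ?ltW.
apply/hard_le; split => [|i iN|i iN _]; first lra.
  by rewrite normx//; lra.
have : 0 <= i%:R * gap by rewrite mulr_ge0// divr_ge0// mulr_ge0// ltW.
by rewrite formx//; lra.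
Qed.

End HardFamily.

(** * Uniform prior on a finite family *)

Section UniformPrior.
Context {R : realType}.

Section DiscreteUniform.
Variable n : nat.

(** Carried by [nat], where all sets are measurable, so the outer probability of any event is a
    proportion. *)
Definition discrete_uniform : set nat -> \bar R :=
  mscale (n.+1%:R^-1)%:nng (msum (fun k => \d_k : measure nat R) n.+1).

HB.instance Definition _ := Measure.on discrete_uniform.

Lemma discrete_uniformE (A : set nat) :
  discrete_uniform A = (#|[pred k : 'I_n.+1 | `[< A k >]]|%:R / n.+1%:R)%:E.
Proof.
rewrite /discrete_uniform /mscale /msum /= mulrC EFinM; congr (_ * _)%E.
rewrite -sumr_const -sumEFin [RHS]big_mkcond /=.
apply: eq_bigr => k _.
rewrite [LHS](@diracE _ _ R (nat_of_ord k) A) inE /=.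
by case: asboolP => kA; [rewrite mem_set | rewrite memNset].
Qed.

Lemma discrete_uniform_setT : discrete_uniform setT = 1%E.
Proof.
rewrite discrete_uniformE (eq_card (B := 'I_n.+1)).
  by rewrite card_ord divff.
by move=> k; rewrite !inE /=; apply/asboolP.
Qed.

HB.instance Definition _ :=
  Measure_isProbability.Build _ _ _ discrete_uniform discrete_uniform_setT.

End DiscreteUniform.

(** The uniform law is an admissible prior under which success within [N] rounds has probability
    below [gamma], so only [tau >= N.+1] qualify. *)
Lemma Compl_HP_ge (d K N : nat) (F : set ('rV[R]_d -> R)) (X : set 'rV[R]_d)
    (Ans : Type) (O : F -> X -> Ans) (eps gamma : R) (T : finType) (phi : T -> F) :
  (0 < #|T|)%N ->
  (forall A : algorithm X Ans K,
     #|[pred r | `[< (rounds O A (phi r) eps <= N%:R%:E)%E >]]|%:R < gamma * #|T|%:R) ->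
  (N.+1%:R%:E <= Compl_HP K O eps gamma)%E.
Proof.
move=> T0 H; have [n cT] : exists n, #|T| = n.+1 by exists #|T|.-1; rewrite prednK.
(* Naturals beyond [n] go to a default index and have mass zero. *)
pose e (k : nat) : T := enum_val (cast_ord (esym cT) (inord k)).
pose c := ereal_inf [set rounds_HP O (discrete_uniform n) (phi \o e) A eps gamma
  | A in [set: algorithm X Ans K]].
apply: le_ereal_sup_tmp; exists c.
  exists _, nat, (discrete_uniform n), (phi \o e); split => // x _ B _.
apply: le_ereal_inf_tmp => _ [A _ <-].
apply: le_ereal_inf_tmp => _ [tau /= Htau <-].
rewrite lee_fin ler_nat ltnNge; apply/negP => tauN.
move: Htau; rewrite measurable_mu_extE// [X in (_ <= X)%E]discrete_uniformE lee_fin.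
apply/negP; rewrite -ltNge ltr_pdivrMr ?ltr0n//.
have := H A; rewrite cT; apply: le_lt_trans; rewrite ler_nat.
have einj : injective (fun k : 'I_n.+1 => e k).
  move=> i j /enum_val_inj/cast_ord_inj; rewrite !inord_val; exact.
pose P := [pred k : 'I_n.+1 | `[< (rounds O A (phi (e k)) eps <= tau%:R%:E)%E >]]. 
rewrite -(fintype.card_image einj P) subset_leq_card//; apply/fintype.subsetP => r.
move=> /fintype.imageP[k]; move=> /asboolP kt ->; apply/asboolP.
by rewrite (le_trans kt)// lee_fin ler_nat.
Qed.

End UniformPrior.

(** * Runs against round-dependent answers *)

Section OracleAnswers.
Context {R : realType} {d K : nat} {F : set ('rV[R]_d -> R)} {X : set 'rV[R]_d}
  {Ans : Type}.
Variables (O : F -> X -> Ans) (A : algorithm X Ans K).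
Implicit Types (f g : F) (x : X) (eps : R).

Lemma not_eps_solution f x eps : (exists2 y : X, val f (val y) <= - (2 * eps) &
  - eps < val f (val x)) -> ~ eps_solution eps f x.
Proof.
case=> y fy fx; rewrite /eps_solution; apply/negP; rewrite -ltNge.
apply: (@lt_le_trans _ _ ((val f (val x))%:E - (val f (val y))%:E)%E).
  by rewrite -EFinB lte_fin; lra.
apply: leeB => //; apply: ge_ereal_inf; exists (val f (val y))%:E => //.
by exists (val y) => //; exact: set_valP.
Qed.

(** Batches are numbered from 0, so [t < N] covers rounds 1 to [N]. *)
Lemma rounds_ge f eps (N : nat) :
  (forall t, (t < N)%N -> forall i, ~ eps_solution eps f (tnth (batch O A f t) i)) ->
  ~ (rounds O A f eps <= N%:R%:E)%E.
Proof.
move=> H; apply/negP; rewrite -ltNge; apply: (@lt_le_trans _ _ N.+1%:R%:E).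
  by rewrite lte_fin ltr_nat.
apply: le_ereal_inf_tmp => _ [t [i ti] <-]; rewrite lee_fin ler_nat ltnS leqNgt.
by apply/negP => tN; exact: H ti.
Qed.

Variable fs : nat -> F.

(** Round [t.+1] is answered by [fs t]. When [fs t] is [hard r t], its queries depend only on the
    signs of the first [t] blocks. *)
Fixpoint hybrid_run (t : nat) : transcript X Ans K :=
  if t is t'.+1 then
    let h := hybrid_run t' in rcons h (A h, map_tuple (O (fs t')) (A h))
  else [::].

(** Locality and induction on rounds. The hypothesis concerns the hybrid queries, whose dependence
    on the signs is controlled. *)
Lemma run_hybrid f (N : nat) : local_oracle O ->
  (forall t, (t < N)%N -> forall i,
    \forall y \near val (tnth (A (hybrid_run t)) i), val f y = val (fs t) y) ->
  forall t, (t <= N)%N -> run O A f t = hybrid_run t.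
Proof.
move=> locO H; elim=> [//|t IH] tN /=; rewrite IH ?(ltnW tN)//.
congr (rcons _ (_, _)); apply: eq_from_tnth => i; rewrite !tnth_map.
by apply: locO; exact: H.
Qed.

End OracleAnswers.

Lemma eq_hybrid_run (R : realType) (d K : nat) (F : set ('rV[R]_d -> R)) (X : set 'rV[R]_d)
    (Ans : Type) (O : F -> X -> Ans) (A : algorithm X Ans K) (fs gs : nat -> F) t :
  (forall s, (s < t)%N -> fs s = gs s) ->
  hybrid_run O A fs t = hybrid_run O A gs t.
Proof.
elim: t => //= t IH H; rewrite IH => [|s st]; last by rewrite H// ltnS ltnW.
by rewrite H.
Qed.

(** * Redrawing the hidden signs *)

Section Rerandomization.
Context {R : realType} {d : nat}.
Variables (p : R) (N b : nat).
Hypotheses (b0 : (0 < b)%N).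
Implicit Types (r u : {ffun 'I_d -> bool}).

(** For fixed [u] this permutes the sign vectors; for fixed [r], a uniform [u] redraws the signs
    from [m] on. *)
Definition flip_tail (m : nat) u r : {ffun 'I_d -> bool} :=
  [ffun k : 'I_d => ((m <= k)%N && u k) (+) r k].

Lemma flip_tailK m u : involutive (flip_tail m u).
Proof. by move=> r; apply/ffunP => k; rewrite !ffunE addKb. Qed.

(* Redrawing the signs from t * b on leaves the point x r fixed, so Hoeffding's
   inequality applies to the redrawn signs for each r separately. *)
Lemma card_form_gt (t j : nat) (c : bool) (s : R) (x : {ffun 'I_d -> bool} -> 'rV[R]_d) :
  (t <= j)%N -> 0 <= s ->
  (forall r r', (forall k : 'I_d, (k < t * b)%N -> r k = r' k) -> x r = x r') ->
  #|[pred r | s * block_norm p b j (x r) < (-1) ^+ c * block_form p b r j (x r)]|%:R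
  <= 2 ^+ d * expR (- (s ^+ 2 * b%:R / 8)).
Proof.
move=> tj s0 xdep.
pose B r (y : 'rV[R]_d) := s * block_norm p b j y < (-1) ^+ c * block_form p b r j y.
have hoeff r (y : 'rV[R]_d) : #|[pred u | B (flip_tail (t * b) u r) y]|%:R <=
    2 ^+ d * expR (- (s ^+ 2 * b%:R / 8)).
  (* The factor [sqrt b] of [block_norm] joins the threshold, whence [s ^+ 2 * b] in the exponent;
     the signs of [r] go into the coefficients. *)
  have sb0 : 0 <= s * Num.sqrt b%:R by rewrite mulr_ge0 ?sqrtr_ge0.
  have := @hoeffding_signs R _ (in_block b j)
    (fun k => (-1) ^+ c * (-1) ^+ r k * y ord0 k) _ sb0.
  rewrite exprMn sqr_sqrtr ?ler0n// card_ord; apply: le_trans.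
  rewrite ler_nat subset_leq_card//; apply/fintype.subsetP => u.
  rewrite !inE /B /block_norm /block_form.
  rewrite mulrCA [X in _ < X]mulrCA ltr_pM2l ?powR_gt0 ?ltr0n// mulrA.
  rewrite [X in _ < X](_ : _ = \sum_(k | in_block b j k)
    (-1) ^+ u k * ((-1) ^+ c * (-1) ^+ r k * y ord0 k)).
    rewrite [X in _ * Num.sqrt X < _ -> _](_ : _ = \sum_(k | in_block b j k)
      ((-1) ^+ c * (-1) ^+ r k * y ord0 k) ^+ 2)//.
    by apply: eq_bigr => k _; rewrite !exprMn !sqrr_sign !mul1r.
  rewrite mulr_sumr; apply: eq_bigr => k /eqP kj; rewrite ffunE.
  have -> : (t * b <= k)%N by rewrite -leq_divRL// kj.
  by rewrite signr_addb; ring.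
(* Double counting: for each [u] the flip permutes the sign vectors and preserves [x r]. *)
have avg : (2 ^+ d * #|[pred r | B r (x r)]|%:R : R) =
    \sum_r #|[pred u | B (flip_tail (t * b) u r) (x r)]|%:R.
  under eq_bigr do rewrite -sum1_card natr_sum big_mkcond.
  rewrite exchange_big/= (eq_bigr (fun=> #|[pred r | B r (x r)]|%:R)).
    by rewrite sumr_const card_ffun card_bool card_ord -[RHS]mulr_natl natrX.
  move=> u _; rewrite -sum1_card natr_sum [RHS]big_mkcond/=.
  rewrite [RHS](reindex_inj (inv_inj (flip_tailK (t * b) u))).
  apply: eq_bigr => r _; rewrite !inE (xdep r (flip_tail (t * b) u r))// => k kt.
  by rewrite ffunE leqNgt kt.
rewrite -(@ler_pM2l _ (2 ^+ d)) ?exprn_gt0// [leLHS]avg.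
apply: le_trans (ler_sum _ (fun r _ => hoeff r (x r))) _.
by rewrite sumr_const card_ffun card_bool card_ord -[leLHS]mulr_natl natrX.
Qed.

End Rerandomization.

Lemma card_union_bound (T I : finType) (P : pred T) (B : I -> pred T) :
  (forall r, P r -> exists q, B q r) -> (#|P| <= \sum_q #|B q|)%N.
Proof.
move=> PB; have card_sum (Q : pred T) : #|Q| = (\sum_r Q r)%N.
  by rewrite -sum1_card big_mkcond/=; apply: eq_bigr => r _; rewrite unfold_in; case: (Q r).
rewrite card_sum; under [leqRHS]eq_bigr do rewrite card_sum.
rewrite exchange_big; apply: leq_sum => r _; case: (boolP (P r)) => // /PB[q qr].
by rewrite (bigD1 q)//= qr.
Qed.

(** * Few sign vectors allow fast success *)

Section FewFastSigns.
Context {R : realType} {d K : nat}.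
Variables (p : R) (N b : nat) (eps : R) (X : set 'rV[R]_d) (Ans : Type).
Hypotheses (p2 : 2 <= p) (b0 : (0 < b)%N) (Nbd : (N * b <= d)%N).
Variables (oracle : @F0 R d p 1 -> X -> Ans) (A : algorithm X Ans K).
Implicit Types (r : {ffun 'I_d -> bool}).

Definition hard_elt r t : F0 p 1 :=
  exist _ (hard p N b eps r t) (mem_set (hard_F0 eps b0 Nbd r t p2)).

(** Union bound over round, query and block: outside the bad events all hybrid queries are good, so
    the true run is the hybrid one and finds no solution. *)
Lemma card_few_rounds : local_oracle oracle -> unit_ball p `<=` X ->
  0 < eps < 1 / 2 -> ((0 < N)%N -> N%:R <= 1 / (4 * eps) `^ p) ->
  #|[pred r | `[< (rounds oracle A (hard_elt r N) eps <= N%:R%:E)%E >]]|%:R <=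
  (N * K * N)%:R * (2 ^+ d * expR (- (slack N eps ^+ 2 * b%:R / 8))).
Proof.
move=> locO BX e01 NM; have /andP[e0 e1] := e01.
have e01' : 0 < eps < 2^-1 by rewrite e0 -div1r.
pose hyb r t := hybrid_run oracle A (hard_elt r) t.
pose x r t i : 'rV[R]_d := val (tnth (A (hyb r t)) i).
(* With [q = (t, i, j)], the exponent selects the lower tail for [j = t] and the upper tail for
   [j > t]. *)
pose B (q : 'I_N * 'I_K * 'I_N) : pred {ffun 'I_d -> bool} :=
  [pred r | (q.1.1 <= q.2)%N && (slack N eps * block_norm p b q.2 (x r q.1.1 q.1.2) <
    (-1) ^+ (q.1.1 == q.2) * block_form p b r q.2 (x r q.1.1 q.1.2))].
have s0 : 0 <= slack N eps by rewrite divr_ge0// ?mulr_ge0 ?ler0n// ltW.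
have cardB q : #|B q|%:R <= 2 ^+ d * expR (- (slack N eps ^+ 2 * b%:R / 8)).
  case: q => -[t i] j; rewrite /B /=; case: (boolP (t <= j)%N) => tj.
    apply: (@card_form_gt R d p b b0 t j _ (slack N eps) (fun r => x r t i)) => //.
    move=> r r' rr'; rewrite /x /hyb (@eq_hybrid_run _ _ _ _ _ _ _ _ _ (hard_elt r'))//.
    move=> s st; apply: val_inj; apply: eq_hard => // k ks; apply: rr'.
    by apply: leq_trans ks _; rewrite leq_mul2r st orbT.
  by rewrite eq_card0 ?mulr_ge0 ?exprn_ge0 ?expR_ge0.
apply: (@le_trans _ _ (\sum_q #|B q|)%:R).
  rewrite ler_nat; apply: card_union_bound => r /= /asboolP rN.
  apply: contrapT => noB; move: rN; apply: rounds_ge => t tN i.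
  have goodx u (uN : (u < N)%N) i' : good p N b eps r u (x r u i').
    have nB (j : 'I_N) : (u <= j)%N -> (-1) ^+ (u == j) * block_form p b r j (x r u i') <=
        slack N eps * block_norm p b j (x r u i').
      move=> uj; rewrite leNgt; apply/negP => lt; apply: noB.
      by exists (Ordinal uN, i', j); rewrite /B /= uj -val_eqE.
    split; first by have := nB (Ordinal uN) (leqnn u); rewrite eqxx expr1 mulN1r.
    move=> j /andP[uj jN]; have := nB (Ordinal jN) (ltnW uj).
    by rewrite /= ltn_eqF// expr0 mul1r.
  have N0 : (0 < N)%N by exact: leq_ltn_trans tN.
  rewrite /batch (run_hybrid (fs := hard_elt r) (N := N))//; last exact: ltnW.
    apply: not_eps_solution.
    have p1 : 1 < p by apply: lt_le_trans p2; rewrite ltr1n.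
    have [y yB yle] := hard_min b0 Nbd r p1 N0 (NM N0) e0.
    by exists (exist _ y (mem_set (BX _ yB))) => //; exact: hard_gt (goodx t tN i).
  by move=> u uN i'; exact: hard_local (goodx u uN i').
rewrite natr_sum (le_trans (ler_sum _ (fun q _ => cardB q)))//.
by rewrite sumr_const !card_prod !card_ord -[leLHS]mulr_natl.
Qed.

End FewFastSigns.

(** * Choice of parameters *)

Lemma cube_root_bound (R : realType) (M e x : R) : 0 <= M -> 0 <= e -> 0 <= x ->
  M <= e `^ (2 / 3) / 8 * x `^ (1 / 3) -> 512 * M ^+ 3 <= e ^+ 2 * x.
Proof.
move=> M0 e0 x0 H.
have : (8 * M) ^+ 3 <= (e `^ (2 / 3) * x `^ (1 / 3)) ^+ 3.
  by rewrite lerXn2r ?nnegrE ?mulr_ge0 ?powR_ge0//; lra.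
rewrite exprMn [X in _ <= X]exprMn -!powR_mulrn ?powR_ge0// -!powRrM.
rewrite !divfK// powRr1// !powR_mulrn//; lra.
Qed.

Theorem theorem3p6 (R : realType) (p : R) (d K : nat) (X : set 'rV[R]_d)
    (eps gamma : R) (q : {poly R})
    (Ans : Type) (oracle : F0 p 1 -> X -> Ans) (M : R) :
  2 <= p -> (1 <= d)%N -> (1 <= K)%N ->
  closed X -> convex_set X -> unit_ball p `<=` X ->
  0 < eps < 1 / 2 ->
  0 < q.[d%:R] -> 1 / q.[d%:R] < gamma < 1 ->
  local_oracle oracle ->
  M = Num.min (1 / (4 * eps) `^ p)
        (eps `^ (2 / 3) / 8 * (d%:R / ln (M * K%:R / gamma)) `^ (1 / 3)) ->
  (M%:E <= Compl_HP K oracle eps gamma)%E.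
Proof.
move=> p2 d1 K1 _ _ BX e01 q0 /andP[gq g1] locO ME.
have /andP[e0 e1] := e01.
have g0 : 0 < gamma by rewrite (lt_trans _ gq)// div1r invr_gt0.
(* For [M <= 1] this gives [N = 0]. *)
have [N [MN NM]] : exists N, M <= N.+1%:R /\ ((0 < N)%N -> N%:R < M).
  have ex : exists n, M <= n.+1%:R.
    by exists (Num.truncn M); exact/ltW/truncnS_gt.
  case: (ex_minnP ex) => N MN Nmin; exists N; split=> // N0.
  rewrite ltNge; apply/negP => MN'; have := Nmin N.-1.
  by rewrite prednK// => /(_ MN'); rewrite leqNgt prednK// leqnn.
suff [b [b0 Nbd small NM']] : exists b, [/\ (0 < b)%N, (N * b <= d)%N,
    (N * K * N)%:R * expR (- (slack N eps ^+ 2 * b%:R / 8)) < gamma &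
    (0 < N)%N -> N%:R <= 1 / (4 * eps) `^ p].
  apply: (@le_trans _ _ N.+1%:R%:E); first by rewrite lee_fin.
  apply: (@Compl_HP_ge _ _ _ _ _ _ _ _ _ _ _ (fun r => hard_elt eps p2 b0 Nbd r N)).
    by rewrite card_ffun card_bool card_ord expn_gt0.
  move=> A; apply: le_lt_trans (card_few_rounds p2 b0 Nbd A locO BX e01 NM') _.
  by rewrite card_ffun card_bool card_ord natrX mulrCA mulrC ltr_pM2r ?exprn_gt0.
(* Without blocks the counting bound is 0, so [b = d] will do. *)
have [N0|N0] := posnP N.
  by exists d; split; rewrite ?N0// !mul0r.
have {}NM := NM N0.
have N1 : 1 <= N%:R :> R by rewrite ler1n.
have K1' : 1 <= K%:R :> R by rewrite ler1n.
(* This makes the logarithm in the definition of [M] positive. *)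
have M1 : 1 < M by exact: le_lt_trans NM.
pose w := M * K%:R / gamma.
have w1 : M * K%:R < w by rewrite /w ltr_pdivlMr ?mulr_gt0//; [rewrite gtr_pMr// mulr_gt0|..]; lra.
have wM : M < w by rewrite (le_lt_trans _ w1)// ler_peMr//; lra.
have w0 : 0 < w by lra.
pose L := ln w.
have L0 : 0 < L by rewrite ln_gt0//; lra.
have d0 : 0 < d%:R :> R by rewrite ltr0n.
have M4 : M <= 1 / (4 * eps) `^ p by rewrite ME ge_min lexx.
have Md : M <= eps `^ (2 / 3) / 8 * (d%:R / L) `^ (1 / 3).
  by rewrite {1}ME ge_min lexx orbT.
clear ME.
have M0 : 0 <= M by lra.
have Lw : expR L = w by rewrite lnK ?posrE.
have wg : w * gamma = M * K%:R by rewrite divfK ?gt_eqF.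
clearbody L; clearbody w.
have key : 512 * M ^+ 3 * L <= eps ^+ 2 * d%:R.
  rewrite -ler_pdivlMr// -mulrA; apply: cube_root_bound Md => //; first exact: ltW.
  by rewrite divr_ge0// ltW.
(* Rounding [d / N] down loses at most half, once [N <= d]. *)
have [b [b0 Nbd bd]] : exists b, [/\ (0 < b)%N, (N * b <= d)%N & d%:R <= 2 * N%:R * b%:R :> R].
  exists (d %/ N)%N.
  (* For [N >= 2], [w > 2] forces [L > 1/2], and [key] yields [N <= M <= M ^+ 3 <= d]. *)
  have Nd : (N <= d)%N.
    have [->//|N2] := eqVneq N 1%N.
    have M2 : 2 < M by rewrite (le_lt_trans _ NM)// ler_nat ltn_neqAle eq_sym N2.
    have L12 : 2^-1 < L.
      rewrite -ltr_expR Lw.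
      have := expR_ge1Dx (- 2^-1 : R); rewrite expRN => h1.
      have h2 := expR_gt0 (2^-1 : R).
      have : (1 + - 2^-1) * expR (2^-1 : R) <= 1 by rewrite -ler_pdivlMr// div1r.
      lra.
    rewrite -(ler_nat R).
    have e21 : eps ^+ 2 <= 1 by rewrite exprn_ile1// ltW//; lra.
    have : eps ^+ 2 * d%:R <= d%:R by rewrite ler_piMl// ltW.
    have M31 : M <= M ^+ 3 by rewrite -[leLHS]expr1 ler_eXn2l//; lra.
    have L512 : 1 <= 512 * L by clear - L12; lra.
    apply: le_trans; apply: le_trans key; rewrite mulrAC.
    rewrite (le_trans (ltW NM))// (le_trans M31)// ler_peMl//.
    exact: le_trans M31.
  have b0 : (0 < d %/ N)%N by rewrite divn_gt0.
  split=> //; first by rewrite mulnC leq_divM.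
  rewrite -!natrM ler_nat (leq_trans (ltnW (ltn_ceil d N0)))// mulnAC leq_mul2r.
  by rewrite mul2n -addnn -addn1 leq_add2l b0 orbT.
exists b; split => //; last by move=> _; exact: le_trans (ltW NM) M4.
have n0 : 0 < N%:R :> R by lra.
(* By [key] and [b >= d / (2 * N)] the right side is at least [512 / 144 * L]. *)
have exps : 3 * L <= slack N eps ^+ 2 * b%:R / 8.
  have -> : slack N eps ^+ 2 * b%:R / 8 = eps ^+ 2 * b%:R / (72 * N%:R ^+ 2).
    by rewrite /slack; field; rewrite gt_eqF.
  rewrite ler_pdivlMr ?mulr_gt0 ?exprn_gt0// -(ler_pM2l n0).
  have nM3 : N%:R ^+ 3 * L <= M ^+ 3 * L.
    by rewrite ler_pM2r// lerXn2r ?nnegrE ?ler0n// ltW.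
  have nL : 0 <= N%:R ^+ 3 * L by rewrite mulr_ge0 ?exprn_ge0// ltW.
  have -> : N%:R * (3 * L * (72 * N%:R ^+ 2)) = 216 * (N%:R ^+ 3 * L) by ring.
  have := ler_wpM2l (sqr_ge0 eps) bd; clear - key nM3 nL; lra.
have w3 : expR (- (slack N eps ^+ 2 * b%:R / 8)) <= w^-1 ^+ 3.
  by rewrite -Lw -expRN -expRM_natl ler_expR; clear - exps; lra.
have v0 : 0 < w^-1 by rewrite invr_gt0.
have nv1 : N%:R * w^-1 <= 1 by rewrite ler_pdivrMr// mul1r ltW// (lt_trans NM).
have v1 : w^-1 <= 1 by rewrite invf_le1//; lra.
have Knv : K%:R * N%:R * w^-1 < gamma.
  rewrite ltr_pdivrMr// [gamma * w]mulrC wg mulrC ltr_pM2r//; lra.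
(* One factor [w^-1] brings [K * N] below [gamma], as [w * gamma = M * K]; the other two absorb the
   remaining [N]. *)
apply: le_lt_trans (ler_wpM2l (ler0n _ _) w3) _.
apply: le_lt_trans Knv; rewrite !natrM.
have -> : N%:R * K%:R * N%:R * w^-1 ^+ 3 =
  K%:R * N%:R * w^-1 * ((N%:R * w^-1) * w^-1) by ring.
rewrite ler_piMr ?mulr_ge0 ?ler0n ?(ltW v0)//.
by rewrite mulr_ile1// ?mulr_ge0 ?ler0n ?(ltW v0).
Qed.
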